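(* For all $\alpha,\beta\in\Delta^+\setminus\varphi^\perp$, one has $$N_H(u_\alpha,u_\beta)=\frac{(\varepsilon_\alpha+1)(\varepsilon_\beta+1)}{4\sqrt2}N_{\alpha,\beta}\,v_{\alpha+\beta}+\frac{(\varepsilon_\alpha\varepsilon_\beta-1)s_{\alpha-\beta}+\varepsilon_\alpha-\varepsilon_\beta}{4\sqrt2}N_{\alpha,-\beta}\,(v_{\alpha-\beta})_{\mathfrak m},$$ where $(v_{\alpha-\beta})_{\mathfrak m}$ denotes the component of $v_{\alpha-\beta}$ along $\mathfrak m$ according to the decomposition $\mathfrak g=\mathfrak v\oplus\mathfrak m$.
   Context: $G$ is a non-compact real semisimple Lie group with Lie algebra $\mathfrak g$ and Killing form $B$; $v\in\mathfrak g$ has compact stabilizer $V\subset G$ under the adjoint action, $\mathfrak v$ is the Lie algebra of $V$, and $\mathfrak m$ is the $B$-orthogonal complement of $\mathfrak v$, identified with the tangent space of the adjoint orbit $G/V$ of $v$ at the identity coset $e$. Let $\mathfrak k\supset\mathfrak v$ be a maximal compact subalgebra, $\mathfrak g=\mathfrak k\oplus\mathfrak p$ the Cartan decomposition, $\mathfrak h_0\subset\mathfrak k$ a maximal abelian subalgebra containing $v$; its complexification $\mathfrak h_c$ is a Cartan subalgebra of $\mathfrak g_c=\mathfrak g\otimes\mathbf C$. $\Delta$ is the set of roots, real on $\mathfrak h_{\mathbf R}=i\mathfrak h_0$, where $B$ is positive definite. For $\psi\in\mathfrak h_{\mathbf R}^*$, $h_\psi\in\mathfrak h_{\mathbf R}$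 satisfies $\psi(h)=B(h_\psi,h)$, and $(\psi,\psi')=B(h_\psi,h_{\psi'})$. $\varphi$ is defined by $v=ih_\varphi$, and $\Delta^+$ is a positive root system with $(\varphi,\alpha)\ge0$ for all $\alpha\in\Delta^+$; $\varphi^\perp$ is the set of elements orthogonal to $\varphi$. A root $\alpha$ is compact ($\varepsilon_\alpha=-1$) if $\mathfrak g^\alpha\subset\mathfrak k_c$, non-compact ($\varepsilon_\alpha=1$) if $\mathfrak g^\alpha\subset\mathfrak p_c$; $s_\alpha=1$ if $\alpha\in\Delta^+$ and $s_\alpha=-1$ otherwise. Let $\tau,\tau_0$ be the complex conjugations of $\mathfrak g_c$ fixing $\mathfrak g$ and $\mathfrak k\oplus i\mathfrak p$ respectively. Root vectors $e_\alpha\in\mathfrak g^\alpha$ are chosen so that $[e_\alpha,e_{-\alpha}]=h_\alpha$, $B(e_\alpha,e_\beta)=\delta_{\alpha,-\beta}$, $[e_\alpha,e_\beta]=N_{\alpha,\beta}e_{\alpha+\beta}$ if $\alpha+\beta\in\Delta$, $\tau_0(e_\alpha)=-e_{-\alpha}$, $\tau(e_\alpha)=\varepsilon_\alpha e_{-\alpha}$, with $N_{\alpha,\beta}$ real, non-zero and $N_{\beta,\alpha}=-N_{\alpha,\beta}=N_{-\alpha,-\beta}=N_{-\beta,\alpha+\beta}=N_{\alpha+\beta,-\alpha}$. A term containing $N_{\alpha,\beta}$ (resp. $N_{\alpha,-\beta}$) is understood to be zero when $\alpha+\beta$ (resp. $\alpha-\beta$) is not a root. For every root $\alpha$ put $$u_\alpha=\tfrac{i^{(1-\varepsilon_\alpha)/2}}{\sqrt2}(e_\alpha+e_{-\alpha}),\qquad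 v_\alpha=\tfrac{i^{(3-\varepsilon_\alpha)/2}}{\sqrt2}s_\alpha(e_\alpha-e_{-\alpha}),$$ which lie in $\mathfrak g$ and satisfy $u_{-\alpha}=u_\alpha$, $v_{-\alpha}=v_\alpha$. Then $\mathfrak m=\mathrm{span}\{u_\alpha,v_\alpha:\alpha\in\Delta^+\setminus\varphi^\perp\}$. Let $H$ be defined by $Hu_\alpha=\varepsilon_\alpha v_\alpha$, $Hv_\alpha=-\varepsilon_\alpha u_\alpha$, and let $J$ be the $G$-invariant almost complex structure on $G/V$ equal to $H|_{\mathfrak m}$ at $e$. $N_H:\mathfrak m\times\mathfrak m\to\mathfrak m$ is the value at $e$ of the Nijenhuis tensor of $J$, normalized by $4N(X,Y)=[JX,JY]-J[JX,Y]-J[X,JY]-[X,Y]$; explicitly, $4N_H(x,y)=[Hx,Hy]_{\mathfrak m}-H[Hx,y]_{\mathfrak m}-H[x,Hy]_{\mathfrak m}-[x,y]_{\mathfrak m}$, with $[\cdot,\cdot]_{\mathfrak m}$ the $\mathfrak m$-component of the bracket of $\mathfrak g$. *)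

(* Defs.v *)
From HB Require Import structures.
From mathcomp Require Import all_boot all_order all_algebra.
From mathcomp Require Import all_classical all_reals all_analysis.
From mathcomp Require Import complex.

Set Implicit Arguments.
Unset Strict Implicit.
Unset Printing Implicit Defensive.

Import Order.TTheory GRing.Theory Num.Theory.
Import numFieldNormedType.Exports.

Local Open Scope classical_set_scope.
Local Open Scope ring_scope.
Local Open Scope complex_scope.

(** * Finite-dimensional Lie algebras *)

HB.mixin Record Vector_isLie (F : fieldType) g of Vector F g := {
  lie : g -> g -> g;
  lie_linearl : forall y, linear (lie^~ y);
  lie_linearr : forall x, linear (lie x);
  liexx : forall x, lie x x = 0;
  lie_jacobi : forall x y z,
    lie x (lie y z) + lie y (lie z x) + lie z (lie x y) = 0
}.

#[short(type="lieAlgType")]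
HB.structure Definition LieAlgebra (F : fieldType) :=
  {g of Vector_isLie F g & Vector F g}.

HB.instance Definition _ (F : fieldType) (g : lieAlgType F) (x : g) :=
  GRing.isLinear.Build F g g *:%R (lie x) (lie_linearr x).

Section LieAlgebraDefs.
Context {F : fieldType} {g : lieAlgType F}.
Implicit Types (x y : g) (U W I : {vspace g}).

Definition ad x : 'End(g) := linfun (lie x).

Definition killing x y : F :=
  \tr (passmx.mxof (vbasis {:g}) (vbasis {:g}) (ad x \o ad y)%VF).

Definition lie_span U W : {vspace g} :=
  <<[seq lie x y | x <- vbasis U, y <- vbasis W]>>%VS.

Definition lie_ideal I := forall x y, y \in I -> lie x y \in I.

Definition solvable_vspace U :=
  exists n : nat, iter n (fun W => lie_span W W) U = 0%VS.

Definition lie_subalgebra U :=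
  forall x y, x \in U -> y \in U -> lie x y \in U.

Definition abelian_vspace U :=
  forall x y, x \in U -> y \in U -> lie x y = 0.

End LieAlgebraDefs.

Definition semisimple_lie (F : fieldType) (g : lieAlgType F) :=
  forall I : {vspace g}, lie_ideal I -> solvable_vspace I -> I = 0%VS.

(** * Lie groups with a given Lie algebra *)

HB.mixin Record Group_isTopGroup G of Group G & Topological G := {
  mulg_continuous : continuous (fun z : G * G => (z.1 * z.2)%g);
  invg_continuous : continuous (fun a : G => (a^-1)%g)
}.

#[short(type="topGroupType")]
HB.structure Definition TopGroup :=
  {G of Group_isTopGroup G & Group G & Topological G}.

(* The topology and the manifold structure of the finite-dimensional real
   space [g] are those of its coordinate space. *)
Notation coord_space g := 'rV_(\dim {:g}).
Notation of_coord := (passmx.vecof (vbasis fullv)).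
Notation to_coord := (passmx.rVof (vbasis fullv)).

(* [G] is a Lie group with Lie algebra [g], exponential map [gexp] and adjoint
   representation [Ad].  The smooth structure of a Lie group is determined by
   its topological group structure, and is given here by the exponential chart
   at the unit ([lg_exp_chart]).  The remaining fields say that [x] is the
   one-parameter subgroup t |-> gexp (t x), that the sum of [g] is the sum of
   one-parameter subgroups (Trotter's formula), that [Ad] is induced by
   conjugation, and that the bracket of [g] is the differential of [Ad] at the
   unit. *)
Record is_lie_group (R : realType) (g : lieAlgType R) (G : topGroupType)
    (gexp : g -> G) (Ad : G -> 'End(g)) : Prop := IsLieGroup {
  lg_hausdorff : hausdorff_space G;
  lg_exp_one_parameter : forall (x : g) (s t : R),
    gexp ((s + t) *: x) = (gexp (s *: x) * gexp (t *: x))%g;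
  lg_exp_chart : exists U : set (coord_space g), [/\ open U, U 0,
    continuous (gexp \o of_coord),
    {in U &, injective (gexp \o of_coord)} &
    forall W, open W -> W `<=` U -> open ((gexp \o of_coord) @` W)];
  lg_exp_add : forall x y : g,
    (fun n : nat =>
       ((gexp (n.+1%:R^-1 *: x) * gexp (n.+1%:R^-1 *: y)) ^+ n.+1)%g)
      @ \oo --> gexp (x + y);
  lg_AdM : forall a b : G, Ad (a * b)%g = (Ad a \o Ad b)%VF;
  lg_Ad_conj : forall (a : G) (x : g),
    gexp (Ad a x) = (a * gexp x * a^-1)%g;
  lg_Ad_diff : forall x y : g,
    (fun t : R => t^-1 *: to_coord (Ad (gexp (t *: x)) y - y))
      @ (0 : R)^' --> to_coord (lie x y)
}.

Definition Ad_stabilizer (R : realType) (g : lieAlgType R) (G : topGroupType)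
  (Ad : G -> 'End(g)) (v : g) : set G := [set a | Ad a v = v].

(* The Lie algebra of a closed subgroup [V]. *)
Definition is_lie_algebra_of (R : realType) (g : lieAlgType R)
    (G : topGroupType) (gexp : g -> G) (V : set G) (U : {vspace g}) :=
  forall x, x \in U <-> forall t : R, V (gexp (t *: x)).

Definition is_killing_orthogonal (F : fieldType) (g : lieAlgType F)
    (U W : {vspace g}) :=
  forall x, x \in W <-> forall y, y \in U -> killing x y = 0.

(* [k] is then a maximal compact subalgebra, and every maximal compact
   subalgebra of a semisimple [g] arises in this way, with a unique [p]. *)
Record cartan_decomposition (R : realType) (g : lieAlgType R)
    (k p : {vspace g}) : Prop := CartanDecomposition {
  cartan_sum : (k + p)%VS = fullv;
  cartan_cap : (k :&: p)%VS = 0%VS;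
  cartan_kk : forall x y, x \in k -> y \in k -> lie x y \in k;
  cartan_kp : forall x y, x \in k -> y \in p -> lie x y \in p;
  cartan_pp : forall x y, x \in p -> y \in p -> lie x y \in k;
  cartan_k_neg : forall x, x \in k -> x != 0 -> killing x x < 0;
  cartan_p_pos : forall x, x \in p -> x != 0 -> 0 < killing x x
}.

Record maximal_abelian_in (F : fieldType) (g : lieAlgType F)
    (h0 k : {vspace g}) : Prop := MaximalAbelianIn {
  maxab_sub : (h0 <= k)%VS;
  maxab_abelian : abelian_vspace h0;
  maxab_max : forall h : {vspace g}, (h0 <= h)%VS -> (h <= k)%VS ->
    abelian_vspace h -> h = h0
}.

(** * Complexification *)

(* The pair [(x, y)] stands for x + i y. *)
Definition complexification (R : rcfType) (g : lmodType R) := (g * g)%type.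

Section Complexification.
Context {R : rcfType} {g : lmodType R}.

HB.instance Definition _ := GRing.Zmodule.on (complexification g).

Definition scale_cplx (c : R[i]) (z : complexification g) :
    complexification g :=
  let: a +i* b := c in (a *: z.1 - b *: z.2, a *: z.2 + b *: z.1).

Fact scale_cplxA a b z :
  scale_cplx a (scale_cplx b z) = scale_cplx (a * b) z.
Proof.
case: a b z => [a a'] [b b'] [x y].
rewrite /scale_cplx /= !(scalerBr, scalerDr, scalerA, scalerBl, scalerDl).
rewrite !opprD !addrA; congr (_, _).
- by rewrite [LHS](AC 4 ((1*4)*2*3))%AC.
- by rewrite [LHS](AC 4 ((1*4)*2*3))%AC.
Qed.

Fact scale_cplx1 : left_id 1 scale_cplx.
Proof.
by case=> x y; congr (_, _); rewrite /= !scale1r scale0r ?subr0 ?addr0.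
Qed.

Fact scale_cplxDr : right_distributive scale_cplx +%R.
Proof.
case=> a b [x y] [x' y']; congr (_, _) => /=; rewrite !scalerDr ?opprD.
- by rewrite addrACA.
- by rewrite addrACA.
Qed.

Fact scale_cplxDl z : {morph scale_cplx^~ z : a b / a + b}.
Proof.
case: z => x y [a b] [a' b']; congr (_, _) => /=; rewrite !scalerDl ?opprD.
- by rewrite addrACA.
- by rewrite addrACA.
Qed.

HB.instance Definition _ := GRing.Zmodule_isLmodule.Build R[i]
  (complexification g) scale_cplxA scale_cplx1 scale_cplxDr scale_cplxDl.

Definition to_cplx (x : g) : complexification g := (x, 0).
Definition re_cplx (z : complexification g) : g := z.1.

End Complexification.

Section ComplexifiedLie.
Context {R : rcfType} {g : lieAlgType R}.
Notation gc := (complexification g).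
Implicit Types (z w : gc) (k p : {vspace g}).

Definition lie_cplx z w : gc :=
  (lie z.1 w.1 - lie z.2 w.2, lie z.1 w.2 + lie z.2 w.1).

Definition killing_cplx z w : R[i] :=
  (killing z.1 w.1 - killing z.2 w.2) +i* (killing z.1 w.2 + killing z.2 w.1).

Definition U_cplx (U : {vspace g}) : set gc :=
  [set z | z.1 \in U /\ z.2 \in U].

(* The conjugation fixing g. *)
Definition tau z : gc := (z.1, - z.2).

Definition cartan_involution k p (x : g) : g :=
  daddv_pi k p x - daddv_pi p k x.

(* The conjugation fixing k + i p. *)
Definition tau0 k p z : gc :=
  (cartan_involution k p z.1, - cartan_involution k p z.2).

(** * Roots *)

(* The real space h_R = i h0 is parametrized by h0 through [hR]; [hR_dual h0]
   is its dual.  Roots are real on h_R, hence they are elements of it. *)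
Definition hR (h0 : {vspace g}) (x : subvs_of h0) : gc :=
  'i%C *: to_cplx (vsval x).

Definition hR_dual (h0 : {vspace g}) := 'Hom(subvs_of h0, R^o).

(* The Killing form is real on h_R. *)
Definition killing_hR (h0 : {vspace g}) (x y : subvs_of h0) : R :=
  complex.Re (killing_cplx (hR x) (hR y)).

Definition root_space (h0 : {vspace g}) (a : hR_dual h0) : set gc :=
  [set z | forall x : subvs_of h0, lie_cplx (hR x) z = (a x)%:C *: z].

Definition is_root (h0 : {vspace g}) : set (hR_dual h0) :=
  [set a | a != 0 /\ exists2 z, root_space a z & z != 0].

Arguments is_root {h0}.

Definition is_killing_dual (h0 : {vspace g})
    (h_ : hR_dual h0 -> subvs_of h0) :=
  forall (psi : hR_dual h0) (x : subvs_of h0),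
    psi x = killing_hR (h_ psi) x.

Definition dual_form (h0 : {vspace g}) (h_ : hR_dual h0 -> subvs_of h0)
    (psi psi' : hR_dual h0) : R :=
  killing_hR (h_ psi) (h_ psi').

Record positive_system (h0 : {vspace g}) (D : set (hR_dual h0)) : Prop :=
  PositiveSystem {
  pos_root : D `<=` is_root;
  pos_total : forall a, is_root a -> D a \/ D (- a);
  pos_antisym : forall a, D a -> ~ D (- a);
  pos_add : forall a b, D a -> D b -> is_root (a + b) -> D (a + b)
}.

(* A root space lies in the complexification of k or in that of p, hence the
   value 0 does not occur at a root ([root_eps_e] below). *)
Definition root_eps k p (h0 : {vspace g}) (a : hR_dual h0) : int :=
  if `[< root_space a `<=` U_cplx k >] then -1
  else if `[< root_space a `<=` U_cplx p >] then 1
  else 0.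

Definition root_sgn (h0 : {vspace g}) (D : set (hR_dual h0))
    (a : hR_dual h0) : int :=
  if `[< D a >] then 1 else -1.

Record normalized_root_vectors k p (h0 : {vspace g})
    (h_ : hR_dual h0 -> subvs_of h0) (e : hR_dual h0 -> gc)
    (N : hR_dual h0 -> hR_dual h0 -> R) : Prop :=
  NormalizedRootVectors {
  rv_root_space : forall a, is_root a -> root_space a (e a);
  rv_lieN : forall a, is_root a -> lie_cplx (e a) (e (- a)) = hR (h_ a);
  rv_killing : forall a b, is_root a -> is_root b ->
    killing_cplx (e a) (e b) = (a == - b)%:R;
  rv_lieD : forall a b, is_root a -> is_root b -> is_root (a + b) ->
    lie_cplx (e a) (e b) = (N a b)%:C *: e (a + b);
  rv_tau0 : forall a, is_root a -> tau0 k p (e a) = - e (- a);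
  rv_tau : forall a, is_root a ->
    tau (e a) = (root_eps k p a)%:~R *: e (- a);
  rv_N_neq0 : forall a b, is_root a -> is_root b -> is_root (a + b) ->
    N a b != 0;
  rv_N_sym : forall a b, is_root a -> is_root b -> is_root (a + b) ->
    [/\ N b a = - N a b, - N a b = N (- a) (- b),
        N (- a) (- b) = N (- b) (a + b) & N (- b) (a + b) = N (a + b) (- a)]
}.

(* Structure constants, with the convention that they are zero when the sum of
   the two roots is not a root. *)
Definition N_conv (h0 : {vspace g}) (N : hR_dual h0 -> hR_dual h0 -> R)
    (a b : hR_dual h0) : R :=
  if `[< is_root (a + b) >] then N a b else 0.

Definition u_cplx k p (h0 : {vspace g}) (e : hR_dual h0 -> gc)
    (a : hR_dual h0) : gc :=
  ('i%C ^ ((1 - root_eps k p a) %/ 2)%Z / (Num.sqrt 2)%:C) *: (e a + e (- a)).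

Definition v_cplx k p (h0 : {vspace g}) (D : set (hR_dual h0))
    (e : hR_dual h0 -> gc) (a : hR_dual h0) : gc :=
  ('i%C ^ ((3 - root_eps k p a) %/ 2)%Z / (Num.sqrt 2)%:C *
     (root_sgn D a)%:~R) *: (e a - e (- a)).

(* For a root [a] these vectors lie in g ([u_rootE], [v_rootE] below), so that
   taking the real part is only a change of type. *)
Definition u_root k p (h0 : {vspace g}) (e : hR_dual h0 -> gc)
    (a : hR_dual h0) : g :=
  re_cplx (u_cplx k p e a).

Definition v_root k p (h0 : {vspace g}) (D : set (hR_dual h0))
    (e : hR_dual h0 -> gc) (a : hR_dual h0) : g :=
  re_cplx (v_cplx k p D e a).

End ComplexifiedLie.

Section ComplexifiedLieTheory.
Context {R : rcfType} {g : lieAlgType R}.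
Notation gc := (complexification g).
Implicit Types (z w : gc) (k p : {vspace g}).

Lemma tauZ (c : R[i]) z : tau (c *: z) = conjc c *: tau z.
Proof.
case: c z => a b [x y]; congr (_, _) => /=.
- by rewrite scalerN scaleNr opprK.
- by rewrite opprD scalerN scaleNr.
Qed.

Lemma tauD z w : tau (z + w) = tau z + tau w.
Proof. by congr (_, _) => /=; rewrite opprD. Qed.

Lemma tauK : involutive (@tau R g).
Proof. by case=> x y; congr (_, _); rewrite /= opprK. Qed.

Lemma lie0l (y : g) : lie 0 y = 0.
Proof.
have := lie_linearl y (-1) 0 0.
by rewrite scaler0 addr0 scaleN1r addNr.
Qed.

Lemma lieNl (x y : g) : lie (- x) y = - lie x y.
Proof. by have := lie_linearl y (-1) x 0; rewrite lie0l !addr0 !scaleN1r. Qed.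

Lemma tau_lie z w : tau (lie_cplx z w) = lie_cplx (tau z) (tau w).
Proof.
congr (_, _) => /=.
- by rewrite linearN /= lieNl opprK.
- by rewrite linearN lieNl opprD.
Qed.

Lemma tau_hR (h0 : {vspace g}) (x : subvs_of h0) : tau (hR x) = - hR x.
Proof.
congr (_, _) => /=;
  by rewrite !(scale0r, scaler0, scale1r, subr0, add0r, oppr0).
Qed.

Lemma lie_cplxNl z w : lie_cplx (- z) w = - lie_cplx z w.
Proof. by congr (_, _) => /=; rewrite !lieNl !opprD. Qed.

Lemma root_space_tau (h0 : {vspace g}) (a : hR_dual h0) z :
  root_space a z -> root_space (- a) (tau z).
Proof.
move=> za x; have /(congr1 (@tau R g)) := za x.
rewrite tau_lie tau_hR lie_cplxNl tauZ conjc_real => /(canRL opprK) ->.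
by rewrite opp_lfunE rmorphN scaleNr.
Qed.

Lemma is_rootN (h0 : {vspace g}) (a : hR_dual h0) : is_root a -> is_root (- a).
Proof.
case=> a0 [z za z0]; split; first by rewrite oppr_eq0.
exists (tau z); first exact: root_space_tau.
apply: contra z0 => /eqP/(congr1 (@tau R g)); rewrite tauK => ->.
by apply/eqP; congr (_, _) => /=; rewrite oppr0.
Qed.

Section RootVectors.
Context {k p h0 : {vspace g}} {h_ : hR_dual h0 -> subvs_of h0}.
Context {e : hR_dual h0 -> gc} {N : hR_dual h0 -> hR_dual h0 -> R}.
Context (eN : normalized_root_vectors k p h_ e N).

Lemma killing0l (y : g) : killing 0 y = 0.
Proof.
have -> : killing 0 y =
    \tr (passmx.mxof (vbasis {:g}) (vbasis {:g}) (0 : 'End(g))).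
  congr (\tr (passmx.mxof _ _ _)); apply/lfunP=> x; rewrite !lfunE /= !lfunE /=.
  by rewrite lie0l.
suff -> : passmx.mxof (vbasis {:g}) (vbasis {:g}) (0 : 'End(g)) = 0.
  by rewrite mxtrace0.
by apply/matrixP=> i j; rewrite !mxE /= lfunE /= linear0.
Qed.

Lemma e_neq0 (a : hR_dual h0) : is_root a -> e a != 0.
Proof.
move=> ra; apply/eqP => e0; have := rv_killing eN ra (is_rootN ra).
rewrite e0 opprK eqxx /killing_cplx !killing0l subrr addr0.
by move=> /(congr1 (@complex.Re R)) /= /eqP; rewrite eq_sym oner_eq0.
Qed.

Lemma root_eps_e (a : hR_dual h0) : is_root a ->
  (root_eps k p a == 1) || (root_eps k p a == -1).
Proof.
move=> ra; have := rv_tau eN ra => E.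
have /eqP := E; rewrite /root_eps; case: ifP => // _; case: ifP => // _.
rewrite scale0r => /eqP/(congr1 (@tau R g)); rewrite tauK => e0.
have := e_neq0 ra; rewrite e0 => /eqP []; congr (_, _); rewrite /= oppr0 //.
Qed.

Lemma root_epsN (a : hR_dual h0) : is_root a ->
  root_eps k p (- a) = root_eps k p a.
Proof.
move=> ra; have /(congr1 (@tau R g)) := rv_tau eN ra.
rewrite tauK tauZ (rv_tau eN (is_rootN ra)) opprK scalerA rmorph_int -intrM.
move=> /eqP; rewrite -subr_eq0 -{1}[e a]scale1r -scalerBl scaler_eq0.
rewrite (negbTE (e_neq0 ra)) orbF subr_eq0.
case/orP: (root_eps_e ra) => /eqP ->;
  case/orP: (root_eps_e (is_rootN ra)) => /eqP -> //;
  by rewrite ?mulr1 ?mul1r rmorphN1 -addr_eq0 -(natrD _ 1 1) pnatr_eq0.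
Qed.

Let conjci : conjc 'i%C = - 'i%C :> R[i].
Proof. by congr (_ +i* _); rewrite /= oppr0. Qed.

Let conjcs (c : R[i]) :
  @conjc R (c / (Num.sqrt 2)%:C) = @conjc R c / (Num.sqrt 2)%:C.
Proof.
rewrite rmorphM fmorphV; congr (_ / _); exact: conjc_real.
Qed.

Lemma re_cplx_tau z : tau z = z -> to_cplx (re_cplx z) = z.
Proof.
case: z => x y [yy]; congr (_, _).
by move/eqP: yy; rewrite eq_sym -addr_eq0 -mulr2n -scaler_nat scaler_eq0
  pnatr_eq0 => /eqP.
Qed.

Lemma u_rootE (a : hR_dual h0) : is_root a ->
  to_cplx (u_root k p e a) = u_cplx k p e a.
Proof.
move=> ra; apply: re_cplx_tau; rewrite /u_cplx tauZ tauD (rv_tau eN ra).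
rewrite (rv_tau eN (is_rootN ra)) root_epsN // opprK -scalerDr scalerA.
rewrite [e (- a) + _]addrC; congr (_ *: _); rewrite conjcs mulrAC.
congr (_ / _); case/orP: (root_eps_e ra) => /eqP ->.
  by have -> : ((1 - 1) %/ 2)%Z = 0 by [];
    rewrite expr0z mulr1; exact: conjc_real.
have -> : ((1 - -1) %/ 2)%Z = 1 by [].
by rewrite expr1z conjci rmorphN1 mulrN1 opprK.
Qed.

Lemma v_rootE (D : set (hR_dual h0)) (a : hR_dual h0) : is_root a ->
  to_cplx (v_root k p D e a) = v_cplx k p D e a.
Proof.
have tauN z : tau (- z) = - tau z by [].
move=> ra; apply: re_cplx_tau; rewrite /v_cplx tauZ tauD tauN (rv_tau eN ra).
rewrite (rv_tau eN (is_rootN ra)) root_epsN // opprK -scalerBr scalerA.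
rewrite -[e (- a) - _]opprB scalerN -scaleNr; congr (_ *: _).
rewrite rmorphM /= rmorph_int conjcs mulrAC -mulNr; congr (_ * _).
rewrite mulrAC -mulNr; congr (_ / _).
case/orP: (root_eps_e ra) => /eqP ->.
  have -> : ((3 - 1) %/ 2)%Z = 1 by [].
  by rewrite expr1z mulr1 conjci opprK.
have -> : ((3 - -1) %/ 2)%Z = 2 by [].
have -> : 'i%C ^ 2 = -1 :> R[i] by rewrite -exprnP sqr_i.
rewrite [(-1)%:~R]rmorphN1 mulrN1 opprK; exact: rmorphN1.
Qed.

End RootVectors.
End ComplexifiedLieTheory.

(** * The Nijenhuis tensor at the base point *)

(* The component along m in the decomposition g = vv + m. *)
Definition mcomp (F : fieldType) (g : lieAlgType F) (vv m : {vspace g})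
    (x : g) : g := daddv_pi m vv x.

Definition nijenhuis (F : fieldType) (g : lieAlgType F) (vv m : {vspace g})
    (H : 'End(g)) (x y : g) : g :=
  4^-1 *: (mcomp vv m (lie (H x) (H y)) - H (mcomp vv m (lie (H x) y))
           - H (mcomp vv m (lie x (H y))) - mcomp vv m (lie x y)).

(* Main.v *)
Require Import Defs.
From HB Require Import structures.
From mathcomp Require Import all_boot all_order all_algebra.
From mathcomp Require Import all_classical all_reals all_analysis.
From mathcomp Require Import complex.
From mathcomp Require Import ring.

Set Implicit Arguments.
Unset Strict Implicit.
Unset Printing Implicit Defensive.

Import Order.TTheory GRing.Theory Num.Theory.
Import numFieldNormedType.Exports.

Local Open Scope classical_set_scope.
Local Open Scope ring_scope.
Local Open Scope complex_scope.

(** The formula is a computation with root vectors once two facts place these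
vectors in the decomposition of the Lie algebra g as vv + m.

The algebra vv is the centralizer of v.  Indeed, t |-> Ad (gexp (t x)) v has
derivative Ad (gexp (t x)) [x, v], so that it is constant exactly when
[x, v] = 0 ([stabilizes_lineP]).  Since v = i h_phi acts on the root space of
c by i (phi, c), the real and imaginary parts of a vector of this space lie in
vv if (phi, c) = 0.  Otherwise they are of the form [v, w], hence they are
orthogonal to the centralizer of v by invariance of the Killing form, and lie
in m.  As the Killing form is negative definite on k, which contains vv, the
spaces vv and m are in direct sum.  Thus the projection onto m fixes u_c and
v_c, or kills both, and in either case H (u_c)_m = eps_c (v_c)_m.

Expanding the brackets of e_a + s e_(-a) and e_b + t e_(-b) for signs s and t
gives a combination of e_(a+b) - s t e_(-a-b) and of e_(a-b) - s t e_(b-a)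
([lie_cplx_root_pairs]): the four brackets of u_a or v_a with u_b or v_b are
combinations of two vectors v, or of two vectors u ([lie_uu], [lie_vv],
[lie_vu], [lie_uv]).  Comparing tau [e_a, e_b] computed in two ways yields
eps_(a+b) = - eps_a eps_b ([N_conv_eps]), which determines all normalizing
factors.  Substituting in the definition of the Nijenhuis tensor, the four
terms have coefficients 1, eps_a, eps_b and eps_a eps_b along v_(a+b), up to a
common factor, whence (eps_a + 1) (eps_b + 1), and similarly along v_(a-b). *)

(** * Lie algebras and the Killing form *)

Section Killing.
Context {R : rcfType} {g : lieAlgType R}.
Implicit Types x y z w : g.
(* For the linear structures on coordinates and matrices. *)
Import passmx.

Lemma lieDl x y z : lie (x + y) z = lie x z + lie y z.
Proof. by have := lie_linearl z 1 x y; rewrite !scale1r. Qed.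

Lemma lieZl (r : R) x y : lie (r *: x) y = r *: lie x y.
Proof. by have := lie_linearl y r x 0; rewrite lie0l !addr0. Qed.

Lemma lieDr x y z : lie z (x + y) = lie z x + lie z y.
Proof. exact: linearD. Qed.

Lemma lieNr x y : lie x (- y) = - lie x y.
Proof. exact: linearN. Qed.

Lemma lieZr (r : R) x y : lie x (r *: y) = r *: lie x y.
Proof. exact: linearZ. Qed.

Lemma lieC x y : lie x y = - lie y x.
Proof.
have := liexx (x + y); rewrite lieDr !lieDl !liexx add0r addr0 addrC.
by move=> /eqP; rewrite addr_eq0 => /eqP.
Qed.

Lemma lie_derivation x y z :
  lie x (lie y z) = lie (lie x y) z + lie y (lie x z).
Proof.
have := lie_jacobi x y z; rewrite [lie z (lie x y)]lieC [lie z x]lieC lieNr.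
by move=> /subr0_eq <-; rewrite subrK.
Qed.

Lemma adE x y : ad x y = lie x y.
Proof. by rewrite lfunE. Qed.

Lemma ad_lie x y : ad (lie x y) = ((ad x \o ad y) - (ad y \o ad x))%VF.
Proof.
apply/lfunP => z; rewrite adE add_lfunE opp_lfunE !comp_lfunE !adE.
by rewrite lie_derivation addrK.
Qed.

Lemma mxtrace_compC (f h : 'End(g)) :
  \tr (mxof (vbasis {:g}) (vbasis {:g}) (f \o h)%VF) =
  \tr (mxof (vbasis {:g}) (vbasis {:g}) (h \o f)%VF).
Proof. by rewrite !(mxof_comp _ _ (vbasisP _)) mxtrace_mulC. Qed.

Lemma killingC x y : killing x y = killing y x.
Proof. exact: mxtrace_compC. Qed.

(** By invariance, B([x, w], y) = B(w, [y, x]). *)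
Lemma killing_lie_eq0 x y w : lie y x = 0 -> killing (lie x w) y = 0.
Proof.
move=> yx0.
have xyC : (ad x \o ad y)%VF = (ad y \o ad x)%VF.
  apply/subr0_eq; rewrite -ad_lie lieC yx0 oppr0.
  by apply/lfunP => z; rewrite adE lie0l lfunE.
rewrite /killing ad_lie comp_lfunDl comp_lfunNl !linearB /=.
by rewrite -comp_lfunA mxtrace_compC -!comp_lfunA xyC subrr.
Qed.

End Killing.

(** * The stabilizer of an element and its centralizer *)

Section Stabilizer.
Context {R : realType} {g : lieAlgType R} {G : topGroupType}.
Context {gexp : g -> G} {Ad : G -> 'End(g)} (G_lie : is_lie_group gexp Ad).
(* For the linear structures on coordinates and matrices. *)
Import passmx.

Lemma cvg_mulmx_coord (T : Type) (F : set_system T) (n m : nat)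
    (f : T -> 'rV[R]_n) (l : 'rV[R]_n) (A : 'M[R]_(n, m)) (j : 'I_m) :
  Filter F -> f @ F --> l -> (f t *m A) 0 j @[t --> F] --> (l *m A) 0 j.
Proof.
move=> FF fl.
have -> : (fun t => (f t *m A) 0 j) = (fun t => \sum_i f t 0 i * A i j).
  by apply/funext => t; rewrite mxE.
rewrite mxE; apply: cvg_big => [|i _]; first exact: add_continuous.
apply: cvgM; last exact: cvg_cst.
exact: (cvg_comp _ _ fl (@coord_continuous R 1 n 0 i l)).
Qed.

Lemma to_coord_inj : injective (to_coord : g -> coord_space g).
Proof. exact/can_inj/rVofK/vbasisP. Qed.

(** The quotients (Ad (gexp 0) y - y) / t have a limit as t tends to 0, although
their numerator does not depend on t. *)
Lemma Ad_exp0 (y : g) : Ad (gexp 0) y = y.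
Proof.
apply/eqP; rewrite -subr_eq0; set w := _ - y; apply/eqP/to_coord_inj.
rewrite linear0; apply/rowP => j.
have := cvg_comp _ _ (lg_Ad_diff G_lie (x := 0) (y := y))
  (@coord_continuous R 1 _ 0 j _).
under [X in X @ _ --> _]funext => t do rewrite /= scaler0 -/w.
rewrite lie0l linear0 => w_cvg.
have id0 : (t : R) @[t --> (0 : R)^'] --> (0 : R) by apply: cvg_within.
have := cvgM id0 w_cvg.
rewrite mul0r => /(_ _) w0.
rewrite [RHS]mxE.
suff : (id \* (fun t : R => (t^-1 *: to_coord w) 0 j)) x @[x --> (0 : R)^'] -->
    to_coord w 0 j.
  by move=> w1; apply: (cvg_unique (@norm_hausdorff _ _) w1 w0).
apply: cvg_near_cst; apply: filterS (nbhs_dnbhs_neq (0 : R)) => t t0.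
by rewrite /= mxE mulVKf.
Qed.

(** Since gexp ((t + h) x) = gexp (t x) gexp (h x), the difference quotient at t
is the image under Ad (gexp (t x)) of the one at 0. *)
Lemma is_derive_Ad_exp (x y : g) (j : 'I_(\dim {:g})) (t : R) :
  is_derive t 1 (fun s : R => to_coord (Ad (gexp (s *: x)) y) 0 j : R)
    (to_coord (Ad (gexp (t *: x)) (lie x y)) 0 j).
Proof.
set f := fun s : R => _; set l := to_coord _ 0 j.
suff dq : h^-1 *: ((f \o shift t) (h *: 1) - f t) @[h --> (0 : R)^'] --> l.
  by apply: DeriveDef; [apply/cvg_ex; exists l | apply: cvg_lim].
pose A := mxof (vbasis {:g}) (vbasis {:g}) (Ad (gexp (t *: x))).
have E z : to_coord (Ad (gexp (t *: x)) z) = to_coord z *m A.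
  exact/rVof_app/vbasisP.
rewrite /l E.
have dAd := lg_Ad_diff G_lie (x := x) (y := y).
have /(_ _) := cvg_mulmx_coord (A := A) (j := j) _ dAd.
apply: cvg_trans; apply: near_eq_cvg; near=> h.
rewrite /= /f /shift /= [h *: 1]mulr1 [h + t]addrC (lg_exp_one_parameter G_lie).
by rewrite (lg_AdM G_lie) comp_lfunE -scalemxAl -E !linearB /= !mxE.
Unshelve. all: by end_near.
Qed.

(** The curve t |-> Ad (gexp (t x)) v has derivative Ad (gexp (t x)) [x, v]. *)
Lemma stabilizes_lineP (v x : g) :
  (forall t : R, Ad_stabilizer Ad v (gexp (t *: x))) <-> lie x v = 0.
Proof.
split=> [stab | xv0 t].
  apply: to_coord_inj; rewrite linear0.
  have := lg_Ad_diff G_lie (x := x) (y := v).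
  under [X in X @ _ --> _]funext => t do rewrite stab subrr linear0 scaler0.
  move=> dAd; apply: (cvg_unique (@norm_hausdorff R _) dAd).
  exact: cvg_cst.
rewrite /Ad_stabilizer /=; apply: to_coord_inj; apply/rowP => j.
rewrite -[v in RHS]Ad_exp0 -(scale0r x).
apply: (is_derive_0_is_cst
  (f := fun s : R => to_coord (Ad (gexp (s *: x)) v) 0 j)) => s.
have := is_derive_Ad_exp x v j s.
by rewrite xv0 !linear0 mxE.
Qed.

End Stabilizer.

(** * The complexification and its root spaces *)

Section Complex.
Context {R : rcfType} {g : lieAlgType R}.
Notation gc := (complexification g).
Implicit Types (x y : g) (z w : gc).

Lemma lie_cplxDl z z' w : lie_cplx (z + z') w = lie_cplx z w + lie_cplx z' w.
Proof.
by congr (_, _) => /=; rewrite !lieDl ?opprD addrACA.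
Qed.

Lemma lie_cplxDr z w w' : lie_cplx z (w + w') = lie_cplx z w + lie_cplx z w'.
Proof.
by congr (_, _) => /=; rewrite !linearD /= ?opprD addrACA.
Qed.

Lemma lie_cplxZl (c : R[i]) z w : lie_cplx (c *: z) w = c *: lie_cplx z w.
Proof.
case: c z w => r s [z1 z2] [w1 w2]; rewrite /lie_cplx /=; congr (_, _) => /=.
  rewrite !lieDl !lieNl !lieZl !scalerBr !scalerDr !opprD !addrA.
  by rewrite [LHS](AC 4 (1*3*4*2))%AC.
rewrite !lieDl !lieNl !lieZl !scalerBr !scalerDr !addrA.
by rewrite [LHS](AC 4 (1*3*4*2))%AC.
Qed.

Lemma lie_cplxZr (c : R[i]) z w : lie_cplx z (c *: w) = c *: lie_cplx z w.
Proof.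
case: c z w => r s [z1 z2] [w1 w2]; rewrite /lie_cplx /=; congr (_, _) => /=.
  rewrite !linearD !linearN !linearZ /= !addrA.
  by rewrite [LHS](AC 4 (1*3*2*4))%AC.
rewrite !linearD !linearN !linearZ /= !addrA.
by rewrite [LHS](AC 4 (1*3*2*4))%AC.
Qed.

Lemma to_cplx_inj : injective (@to_cplx R g).
Proof. by move=> x y []. Qed.

Lemma to_cplxD x y : to_cplx (x + y) = to_cplx x + to_cplx y.
Proof. by congr (_, _); rewrite /= addr0. Qed.

Lemma to_cplxN x : to_cplx (- x) = - to_cplx x.
Proof. by congr (_, _); rewrite /= oppr0. Qed.

Lemma to_cplxZ (r : R) x : to_cplx (r *: x) = r%:C *: to_cplx x.
Proof.
by congr (_, _); rewrite /= ?scaler0 ?scale0r ?subr0 ?addr0.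
Qed.

Lemma to_cplx_lie x y : to_cplx (lie x y) = lie_cplx (to_cplx x) (to_cplx y).
Proof.
by congr (_, _); rewrite /= ?lie0l ?linear0 ?subr0 ?addr0.
Qed.

Lemma scale_realE (r : R) z : r%:C *: z = (r *: z.1, r *: z.2).
Proof. by congr (_, _); rewrite /= scale0r ?subr0 ?addr0. Qed.

Lemma re_cplxZ_mem (U : {vspace g}) (c : R[i]) z :
  z.1 \in U -> z.2 \in U -> re_cplx (c *: z) \in U.
Proof. by case: c => r s z1 z2; rewrite rpredB ?rpredZ. Qed.

(** An element i x of i h0 acts on z by the real scalar a x; this is the same
condition on the real and imaginary parts of z. *)
Lemma root_spaceP (h0 : {vspace g}) (a : hR_dual h0) z :
  root_space a z <-> forall x : subvs_of h0,
    lie (vsval x) z.1 = a x *: z.2 /\ lie (vsval x) z.2 = - (a x *: z.1).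
Proof.
suff E (x : subvs_of h0) : lie_cplx (hR x) z = (a x)%:C *: z <->
    (lie (vsval x) z.1 = a x *: z.2 /\ lie (vsval x) z.2 = - (a x *: z.1)).
  by split=> za x; apply/E/za.
have -> : hR x = (0, vsval x).
  by congr (_, _); rewrite /= ?scale0r ?scaler0 ?scale1r ?subr0 ?add0r.
rewrite (scale_realE (a x) z) /lie_cplx /= !lie0l !add0r.
by split=> [[<- <-]|[-> ->]]; rewrite opprK.
Qed.

Lemma root_space_lie (h0 : {vspace g}) (a b : hR_dual h0) z w :
  root_space a z -> root_space b w -> root_space (a + b) (lie_cplx z w).
Proof.
move=> /root_spaceP za /root_spaceP wb; apply/root_spaceP => x.
have [z1 z2] := za x; have [w1 w2] := wb x.
have -> : (a + b) x = a x + b x by rewrite add_lfunE.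
rewrite /lie_cplx /= !lieDr !lieNr !(lie_derivation (vsval x)) z1 z2 w1 w2.
rewrite !lieNr !lieNl !lieZl !lieZr !scalerBr !scalerDr !scalerDl !opprD !opprK.
by split; rewrite !addrA [LHS](AC 4 (3*2*1*4))%AC.
Qed.

End Complex.

(** * Brackets of the vectors u and v *)

Section Coefficients.
Context {R : rcfType}.

(** The normalizing factors of [u_cplx] and [v_cplx] at a root for which
[root_eps] is n. *)
Definition u_coef (n : int) : R[i] :=
  'i%C ^ ((1 - n) %/ 2)%Z / (Num.sqrt 2)%:C.

Definition v_coef (n : int) : R[i] :=
  'i%C ^ ((3 - n) %/ 2)%Z / (Num.sqrt 2)%:C.

(** The sign left over when the factor of a bracket of two vectors u is
expressed by the factor of a vector v, see [u_coefM]. *)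
Definition coef_sgn (m n : int) : R :=
  if (m == 1) && (n == 1) then -1 else 1.

Lemma sqrt2_neq0 : Num.sqrt 2 != 0 :> R.
Proof. by rewrite sqrtr_eq0 -ltNge ltr0n. Qed.

Lemma iiE : 'i%C * 'i%C = -1 :> R[i].
Proof. by rewrite -expr2 sqr_i. Qed.

Lemma u_coef1 : u_coef 1 = 1 / (Num.sqrt 2)%:C.
Proof. by rewrite /u_coef -[X in _ ^ X]/(Posz 0) expr0z. Qed.

Lemma u_coefN1 : u_coef (-1) = 'i%C / (Num.sqrt 2)%:C.
Proof. by rewrite /u_coef -[X in _ ^ X]/(Posz 1) expr1z. Qed.

Lemma v_coef1 : v_coef 1 = 'i%C / (Num.sqrt 2)%:C.
Proof. by rewrite /v_coef -[X in _ ^ X]/(Posz 1) expr1z. Qed.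

Lemma v_coefN1 : v_coef (-1) = -1 / (Num.sqrt 2)%:C.
Proof. by rewrite /v_coef -[X in _ ^ X]/(Posz 2) -exprnP sqr_i. Qed.

Lemma v_coefE (n : int) : (n == 1) || (n == -1) -> v_coef n = 'i%C * u_coef n.
Proof.
case/orP => /eqP ->; rewrite ?(u_coef1, v_coef1, u_coefN1, v_coefN1) mulrA.
  by rewrite mulr1.
by rewrite iiE.
Qed.

(** If [root_eps] is m at a and n at b, it is - m n at the root a + b by
[N_conv_eps], hence the argument of [v_coef]. *)
Lemma u_coefM (m n : int) :
  (m == 1) || (m == -1) -> (n == 1) || (n == -1) ->
  u_coef m * u_coef n = (coef_sgn m n / Num.sqrt 2)%:C * v_coef (- (m * n)).
Proof.
have -> x : (x / Num.sqrt 2)%:C = x%:C / (Num.sqrt 2)%:C :> R[i].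
  by rewrite rmorphM fmorphV.
case/orP => /eqP -> /orP [] /eqP ->; rewrite /coef_sgn ?eqxx /=.
- by rewrite mulr1 u_coef1 v_coefN1 rmorphN1; ring.
- by rewrite mul1r opprK u_coef1 u_coefN1 v_coef1; ring.
- by rewrite mulr1 opprK u_coef1 u_coefN1 v_coef1; ring.
- by rewrite mulrNN mulr1 u_coefN1 v_coefN1 mulrACA iiE; ring.
Qed.

End Coefficients.

Section RootBrackets.
Context {R : rcfType} {g : lieAlgType R} {k p h0 : {vspace g}}.
Context {h_ : hR_dual h0 -> subvs_of h0}.
Context {e : hR_dual h0 -> complexification g}.
Context {N : hR_dual h0 -> hR_dual h0 -> R}.
Context (eN : normalized_root_vectors k p h_ e N).
Context {D : set (hR_dual h0)} (DP : positive_system D).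
Implicit Types a b c : hR_dual h0.
Notation eps := (root_eps k p).
Notation Nc := (N_conv N).
Notation u := (u_root k p e).
Notation vr := (v_root k p D e).

(** The convention on structure constants covers the case in which a + b is not
a root: the bracket lies in the root space of a + b, which is then zero. *)
Lemma lie_root_vectors a b : is_root a -> is_root b -> a + b != 0 ->
  lie_cplx (e a) (e b) = (Nc a b)%:C *: e (a + b).
Proof.
move=> ra rb ab0; rewrite /N_conv; case: asboolP => [rab|nrab].
  exact: (rv_lieD eN).
rewrite scale0r; apply/eqP/negPn/negP => z0; apply: nrab; split=> //.
exists (lie_cplx (e a) (e b)) => //.
by apply: root_space_lie; apply: (rv_root_space eN).
Qed.

Lemma N_convNN a b : is_root a -> is_root b -> Nc (- a) (- b) = - Nc a b.
Proof.
move=> ra rb; rewrite /N_conv -opprD.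
case: asboolP => [rab|nrab]; case: asboolP => [rab'|nrab'].
- by have [_ <-] := rv_N_sym eN ra rb rab'.
- by case: nrab'; rewrite -[a + b]opprK; apply: is_rootN.
- by case: nrab; apply: is_rootN.
- by rewrite oppr0.
Qed.

(** The value at a + b is read off from the conjugate of [e_a, e_b]: it is
N eps_(a+b) e_(-a-b), and also eps_a eps_b [e_(-a), e_(-b)], which is
- N eps_a eps_b e_(-a-b). *)
Lemma N_conv_eps a b : is_root a -> is_root b ->
  Nc a b = 0 \/ is_root (a + b) /\ eps (a + b) = - (eps a * eps b).
Proof.
move=> ra rb; have [rab|nrab] := pselect (is_root (a + b)); last first.
  by left; rewrite /N_conv asboolF.
right; split=> //.
have ab0 : a + b != 0 by case: rab.
have ab0' : - a + - b != 0 by rewrite -opprD oppr_eq0.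
have [rna rnb rnab] := And3 (is_rootN ra) (is_rootN rb) (is_rootN rab).
have := congr1 (@tau R g) (lie_root_vectors ra rb ab0).
rewrite tau_lie tauZ (rv_tau eN ra) (rv_tau eN rb) (rv_tau eN rab).
rewrite lie_cplxZl lie_cplxZr lie_root_vectors // N_convNN // conjc_real -opprD.
have e0 := e_neq0 eN rnab.
rewrite !scalerA => /eqP.
rewrite -subr_eq0 -scalerBl scaler_eq0 (negbTE e0) orbF.
have N0 : (Nc a b)%:C != 0 :> R[i].
  rewrite /N_conv asboolT //; apply/eqP => /(congr1 (@complex.Re R)) /= /eqP.
  exact/negP/(rv_N_neq0 eN).
rewrite rmorphN /= mulrN -opprD oppr_eq0 [X in _ + X]mulrC -mulrDl.
rewrite mulf_eq0 (negbTE N0) orbF -intrM -intrD.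
by rewrite intr_eq0 addrC addr_eq0 => /eqP.
Qed.

(** All brackets of the vectors u and v are instances, for signs s and t: the
vectors u and v are proportional to [e a + e (- a)] and [e a - e (- a)]. *)
Lemma lie_cplx_root_pairs a b (s t : R[i]) : is_root a -> is_root b ->
  a + b != 0 -> a - b != 0 -> t * t = 1 ->
  lie_cplx (e a + s *: e (- a)) (e b + t *: e (- b)) =
  (Nc a b)%:C *: (e (a + b) - (s * t) *: e (- (a + b)))
  + (t * (Nc a (- b))%:C) *: (e (a - b) - (s * t) *: e (- (a - b))).
Proof.
move=> ra rb ab0 amb0 tt.
have rna := is_rootN ra; have rnb := is_rootN rb.
have Epp := lie_root_vectors ra rb ab0.
have Epm := lie_root_vectors ra rnb amb0.
have Emm : lie_cplx (e (- a)) (e (- b)) = (- Nc a b)%:C *: e (- (a + b)).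
  by rewrite opprD lie_root_vectors ?N_convNN // -opprD oppr_eq0.
have Emp : lie_cplx (e (- a)) (e b) = (- Nc a (- b))%:C *: e (- (a - b)).
  rewrite -N_convNN // opprK opprB addrC lie_root_vectors //.
  by rewrite -oppr_eq0 opprD opprK.
rewrite lie_cplxDl !lie_cplxDr !lie_cplxZl !lie_cplxZr Epp Epm Emm Emp.
rewrite !scalerBr !scalerA.
rewrite !rmorphN /=.
have -> : s * - (Nc a (- b))%:C = - (t * (Nc a (- b))%:C * (s * t)).
  by rewrite -[LHS]mul1r -tt; ring.
have -> : s * t * - (Nc a b)%:C = - ((Nc a b)%:C * (s * t)) by ring.
by rewrite !scaleNr [LHS](AC (2*2) ((1*4)*(2*3)))%AC.
Qed.

Lemma u_cplxE a : u_cplx k p e a = u_coef (eps a) *: (e a + e (- a)).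
Proof. by []. Qed.

Lemma v_cplxE a :
  v_cplx k p D e a = (v_coef (eps a) * (root_sgn D a)%:~R) *: (e a - e (- a)).
Proof. by []. Qed.

Lemma root_sgn_sqr a : (root_sgn D a)%:~R * (root_sgn D a)%:~R = 1 :> R[i].
Proof. by rewrite /root_sgn; case: asbool; rewrite ?mulr1 ?mulrNN ?mulr1. Qed.

(** The component of a bracket along [e (a + b) - e (- (a + b))] as an element
of the real form g.  The vector [v_root] is meaningful only at a root: for a + b
not a root, N vanishes and so do both sides. *)
Lemma scale_v_root a b : is_root a -> is_root b ->
  (u_coef (eps a) * u_coef (eps b) * (Nc a b)%:C) *: (e (a + b) - e (- (a + b)))
  = to_cplx ((coef_sgn (eps a) (eps b) / Num.sqrt 2
              * ((root_sgn D (a + b))%:~R * Nc a b)) *: vr (a + b)).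
Proof.
move=> ra rb; have [N0|[rab eab]] := N_conv_eps ra rb.
  by rewrite N0 !mulr0 !scale0r.
rewrite to_cplxZ (v_rootE eN) // v_cplxE scalerA; congr (_ *: _).
rewrite u_coefM ?(root_eps_e eN) // eab.
move: (coef_sgn _ _ / _) (v_coef _) => q l.
have ss := root_sgn_sqr (a + b).
rewrite !rmorphM /= rmorph_int; move: (_%:~R) ss => s ss.
by rewrite -[LHS]mulr1 -ss; ring.
Qed.

Lemma scale_u_root a b : is_root a -> is_root b ->
  ('i%C * (u_coef (eps a) * u_coef (eps b)) * (Nc a b)%:C)
    *: (e (a + b) + e (- (a + b)))
  = to_cplx ((- (coef_sgn (eps a) (eps b) / Num.sqrt 2) * Nc a b) *: u (a + b)).
Proof.
move=> ra rb; have [N0|[rab eab]] := N_conv_eps ra rb.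
  by rewrite N0 !mulr0 !scale0r.
rewrite to_cplxZ (u_rootE eN) // u_cplxE scalerA; congr (_ *: _).
rewrite u_coefM ?(root_eps_e eN) // -eab v_coefE ?(root_eps_e eN) //.
move: (coef_sgn _ _ / _) (u_coef _) => q l.
transitivity ('i%C * 'i%C * (q%:C * l * (Nc a b)%:C)); first by ring.
by rewrite iiE rmorphM rmorphN /=; ring.
Qed.

Lemma root_sgn_pos a : D a -> root_sgn D a = 1.
Proof. by move=> Da; rewrite /root_sgn asboolT. Qed.

Section PositivePair.
Context {a b : hR_dual h0} (Da : D a) (Db : D b) (ab : a != b).
Notation q := (coef_sgn (eps a) (eps b) / Num.sqrt 2).
Notation Nab := (Nc a b).
Notation Nab' := (Nc a (- b)).
Notation s := (root_sgn D (a - b))%:~R.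

Let ra : is_root a. Proof. exact: pos_root DP _ Da. Qed.
Let rb : is_root b. Proof. exact: pos_root DP _ Db. Qed.
Let rnb : is_root (- b). Proof. exact: is_rootN. Qed.

Let ab0 : a + b != 0.
Proof.
apply/eqP => /eqP; rewrite addr_eq0 => /eqP ab'; apply: (pos_antisym DP Db).
by rewrite -ab'.
Qed.

Let amb0 : a - b != 0. Proof. by rewrite subr_eq0. Qed.

Let epsNb : eps (- b) = eps b. Proof. exact: root_epsN eN _ rb. Qed.

Let sgnN : (root_sgn D (a + b))%:~R * Nab = Nab.
Proof.
rewrite /N_conv; case: asboolP => rab; last by rewrite mulr0.
by rewrite root_sgn_pos ?mul1r //; apply: (pos_add DP).
Qed.

Let v_sum : (u_coef (eps a) * u_coef (eps b) * Nab%:C)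
    *: (e (a + b) - e (- (a + b))) = to_cplx ((q * Nab) *: vr (a + b)).
Proof. by rewrite -{2}sgnN scale_v_root. Qed.

Let v_dif : (u_coef (eps a) * u_coef (eps b) * Nab'%:C)
    *: (e (a - b) - e (- (a - b))) = to_cplx ((q * (s * Nab')) *: vr (a - b)).
Proof. by rewrite -epsNb scale_v_root. Qed.

Let u_sum : ('i%C * (u_coef (eps a) * u_coef (eps b)) * Nab%:C)
    *: (e (a + b) + e (- (a + b))) = to_cplx ((- q * Nab) *: u (a + b)).
Proof. exact: scale_u_root. Qed.

Let u_dif : ('i%C * (u_coef (eps a) * u_coef (eps b)) * Nab'%:C)
    *: (e (a - b) + e (- (a - b))) = to_cplx ((- q * Nab') *: u (a - b)).
Proof. by rewrite -epsNb scale_u_root. Qed.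

Let uE c : is_root c -> to_cplx (u c) = u_coef (eps c) *: (e c + 1 *: e (- c)).
Proof. by move=> rc; rewrite (u_rootE eN) // u_cplxE scale1r. Qed.

Let vE c : D c ->
  to_cplx (vr c) = ('i%C * u_coef (eps c)) *: (e c + (-1) *: e (- c)).
Proof.
move=> Dc; have rc : is_root c := pos_root DP Dc.
rewrite (v_rootE eN) // v_cplxE root_sgn_pos // mulr1 scaleN1r v_coefE //.
exact: (root_eps_e eN).
Qed.

Lemma lie_uu :
  lie (u a) (u b) = (q * Nab) *: vr (a + b) + (q * (s * Nab')) *: vr (a - b).
Proof.
apply: to_cplx_inj; rewrite to_cplx_lie to_cplxD -v_sum -v_dif !uE //.
rewrite lie_cplxZl lie_cplxZr scalerA.
rewrite lie_cplx_root_pairs ?mulr1 // mul1r !scale1r.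
by rewrite scalerDr !scalerA.
Qed.

Lemma lie_vv :
  lie (vr a) (vr b) =
  - ((q * Nab) *: vr (a + b)) + (q * (s * Nab')) *: vr (a - b).
Proof.
apply: to_cplx_inj.
rewrite to_cplx_lie to_cplxD to_cplxN -v_sum -v_dif !vE //.
rewrite lie_cplxZl lie_cplxZr scalerA.
rewrite lie_cplx_root_pairs ?mulrNN ?mulr1 // !scale1r.
move: (u_coef _) (u_coef (eps b)) (e (a + b) - _) (e (a - b) - _) => x y X Y.
have -> : 'i%C * x * ('i%C * y) = - (x * y).
  by rewrite mulrACA iiE mulN1r.
by rewrite mulN1r !scaleNr scalerBr opprB !scalerA addrC.
Qed.

Lemma lie_vu :
  lie (vr a) (u b) = (- q * Nab) *: u (a + b) + (- q * Nab') *: u (a - b).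
Proof.
apply: to_cplx_inj; rewrite to_cplx_lie to_cplxD -u_sum -u_dif vE // uE //.
rewrite lie_cplxZl lie_cplxZr scalerA.
rewrite lie_cplx_root_pairs ?mulr1 // !mul1r.
by rewrite !scaleN1r !opprK scalerDr !scalerA !mulrA.
Qed.

Lemma lie_uv :
  lie (u a) (vr b) = (- q * Nab) *: u (a + b) - (- q * Nab') *: u (a - b).
Proof.
apply: to_cplx_inj.
rewrite to_cplx_lie to_cplxD to_cplxN -u_sum -u_dif vE // uE //.
rewrite lie_cplxZl lie_cplxZr scalerA.
rewrite lie_cplx_root_pairs ?mulrNN ?mulr1 // !mul1r.
rewrite !scaleN1r !opprK mulN1r scaleNr scalerBr !scalerA.
by rewrite [u_coef _ * (_ * _)]mulrCA.
Qed.

End PositivePair.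

End RootBrackets.

(** * The position of root vectors relative to the centralizer of v *)

Section RootDecomposition.
Context {R : rcfType} {g : lieAlgType R} {h0 : {vspace g}}.
Implicit Types (c : hR_dual h0) (x : subvs_of h0).

Lemma killing_hRC x y : killing_hR x y = killing_hR y x.
Proof.
by rewrite /killing_hR /killing_cplx /=; congr (_ - _); apply: killingC.
Qed.

Lemma dual_formE (h_ : hR_dual h0 -> subvs_of h0) (phi c : hR_dual h0) :
  is_killing_dual h_ -> dual_form h_ phi c = c (h_ phi).
Proof. by move=> hP; rewrite /dual_form killing_hRC -hP. Qed.

Lemma to_cplx_ihR (v : g) x : to_cplx v = 'i%C *: hR x -> v = - vsval x.
Proof.
by case=> -> _; rewrite /= !(scale0r, scale1r, scaler0, add0r, addr0, subr0).
Qed.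

Lemma root_space_centralizes c x z : root_space c z -> c x = 0 ->
  lie z.1 (vsval x) = 0 /\ lie z.2 (vsval x) = 0.
Proof.
move=> /root_spaceP /(_ x) [z1 z2] cx0.
by rewrite lieC z1 lieC z2 cx0 !scale0r !oppr0.
Qed.

(** Both parts of z are brackets with x, up to the factor c x. *)
Lemma root_space_killing_eq0 c x z y : root_space c z -> c x != 0 ->
  lie y (vsval x) = 0 -> killing z.1 y = 0 /\ killing z.2 y = 0.
Proof.
move=> /root_spaceP /(_ x) [zx1 zx2] cx0 yx0.
have -> : z.1 = lie (vsval x) (- (c x)^-1 *: z.2).
  by rewrite lieZr zx2 scalerN scaleNr opprK scalerA mulVf ?scale1r.
have -> : z.2 = lie (vsval x) ((c x)^-1 *: z.1).
  by rewrite lieZr zx1 scalerA mulVf ?scale1r.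
by rewrite !killing_lie_eq0.
Qed.

End RootDecomposition.

Lemma daddv_pi_eq0 (F : fieldType) (vT : vectType F) (U V : {vspace vT}) w :
  (U :&: V = 0)%VS -> w \in V -> daddv_pi U V w = 0.
Proof.
move=> UV0 wV; have VU0 : (V :&: U = 0)%VS by rewrite capvC.
have wUV : (w \in U + V)%VS by apply: subvP (addvSr U V) _ wV.
apply: (addIr w); rewrite add0r.
by rewrite -{2}(daddv_pi_id VU0 wV) daddv_pi_add.
Qed.

Lemma root_uv_mem (R : rcfType) (g : lieAlgType R) (k p h0 U : {vspace g})
    (D : set (hR_dual h0)) (e : hR_dual h0 -> complexification g) c :
  (e c).1 \in U -> (e c).2 \in U -> (e (- c)).1 \in U -> (e (- c)).2 \in U ->
  u_root k p e c \in U /\ v_root k p D e c \in U.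
Proof. by move=> *; split; apply: re_cplxZ_mem; rewrite /= ?rpredB ?rpredD. Qed.

Lemma scale_comb (R : pzRingType) (V : lmodType R) (r r' s s' : R) (x y : V) :
  (r *: x + s *: y) - (r' *: x + s' *: y) = (r - r') *: x + (s - s') *: y.
Proof. by rewrite !scalerBl opprD addrACA. Qed.

(** * The Nijenhuis tensor *)

Lemma nijenhuisxx (R : rcfType) (g : lieAlgType R) (vv m : {vspace g})
  (H : 'End(g)) (y : g) : nijenhuis vv m H y y = 0.
Proof.
rewrite /nijenhuis !liexx [lie y (H y)]lieC /mcomp.
have -> : daddv_pi m vv 0 = 0 by apply: linear0.
have -> : daddv_pi m vv (- lie (H y) y) = - daddv_pi m vv (lie (H y) y).
  by apply: linearN.
by rewrite [H (- _)]linearN opprK sub0r addNr subr0 scaler0.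
Qed.

(** If 2 a were a root, the antisymmetry of N would still give N a a = 0. *)
Lemma N_convxx (R : rcfType) (g : lieAlgType R) (k p h0 : {vspace g})
    (h_ : hR_dual h0 -> subvs_of h0) (e : hR_dual h0 -> complexification g)
    (N : hR_dual h0 -> hR_dual h0 -> R) (a : hR_dual h0) :
  normalized_root_vectors k p h_ e N -> is_root a -> N_conv N a a = 0.
Proof.
move=> eN ra; rewrite /N_conv; case: asboolP => // raa.
have [/eqP + _ _ _] := rv_N_sym eN ra ra raa.
by rewrite -addr_eq0 -mulr2n mulrn_eq0 => /eqP.
Qed.

Lemma N_conv_xNx (R : rcfType) (g : lieAlgType R) (h0 : {vspace g})
    (N : hR_dual h0 -> hR_dual h0 -> R) (a : hR_dual h0) :
  N_conv N a (- a) = 0.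
Proof. by rewrite /N_conv subrr asboolF // => -[/eqP]. Qed.

Theorem lemma6p1 (R : realType) (g : lieAlgType R) (G : topGroupType)
  (gexp : g -> G) (Ad : G -> 'End(g))
  (G_lie : is_lie_group gexp Ad)
  (G_semisimple : semisimple_lie g)
  (G_noncompact : ~ compact [set: G])
  (v : g)
  (V_compact : compact (Ad_stabilizer Ad v))
  (vv m : {vspace g})
  (vvP : is_lie_algebra_of gexp (Ad_stabilizer Ad v) vv)
  (mP : is_killing_orthogonal vv m)
  (k p h0 : {vspace g})
  (vv_sub_k : (vv <= k)%VS)
  (kpP : cartan_decomposition k p)
  (h0P : maximal_abelian_in h0 k)
  (v_h0 : v \in h0)
  (h_ : hR_dual h0 -> subvs_of h0)
  (h_P : is_killing_dual h_)
  (phi : hR_dual h0)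
  (phiP : to_cplx v = 'i%C *: hR (h_ phi))
  (Dpos : set (hR_dual h0))
  (DposP : positive_system Dpos)
  (phi_ge0 : forall a, Dpos a -> 0 <= dual_form h_ phi a)
  (e : hR_dual h0 -> complexification g)
  (N : hR_dual h0 -> hR_dual h0 -> R)
  (eNP : normalized_root_vectors k p h_ e N)
  (H : 'End(g))
  (H_u : forall a, is_root a ->
     H (u_root k p e a) = (root_eps k p a)%:~R *: v_root k p Dpos e a)
  (H_v : forall a, is_root a ->
     H (v_root k p Dpos e a) = - (root_eps k p a)%:~R *: u_root k p e a)
  (a b : hR_dual h0)
  (Da : Dpos a) (a_phi : dual_form h_ phi a != 0)
  (Db : Dpos b) (b_phi : dual_form h_ phi b != 0) :
  let eps (c : hR_dual h0) := root_eps k p c in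
  let s := root_sgn Dpos in
  nijenhuis vv m H (u_root k p e a) (u_root k p e b) =
    (((eps a + 1) * (eps b + 1))%:~R / (4 * Num.sqrt 2) * N_conv N a b)
      *: v_root k p Dpos e (a + b)
    + (((eps a * eps b - 1) * s (a - b) + eps a - eps b)%:~R
         / (4 * Num.sqrt 2) * N_conv N a (- b))
      *: mcomp vv m (v_root k p Dpos e (a - b)).
Proof.
move=> eps s.
have ra : is_root a := pos_root DposP Da.
have rb : is_root b := pos_root DposP Db.
have rnb := is_rootN rb.
set x := h_ phi in phiP *.
have vx : v = - vsval x := to_cplx_ihR phiP.
have vvE y : y \in vv <-> lie y (vsval x) = 0.
  apply: (iff_trans (vvP y)); apply: (iff_trans (stabilizes_lineP G_lie v y)).
  by rewrite vx lieNr; split=> [/eqP|->]; rewrite ?oppr0 // oppr_eq0 => /eqP.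
have mvv0 : (m :&: vv = 0)%VS.
  apply/eqP; rewrite -subv0; apply/subvP => y; rewrite memv_cap memv0.
  case/andP=> ym yvv; apply/negPn/negP => y0.
  have := cartan_k_neg kpP (subvP vv_sub_k _ yvv) y0.
  by rewrite (mP y).1 // ltxx.
have uv_vv c : is_root c -> c x = 0 ->
    u_root k p e c \in vv /\ v_root k p Dpos e c \in vv.
  move=> rc cx0; have ncx0 : (- c) x = 0 by rewrite opp_lfunE cx0 oppr0.
  have [e1 e2] := root_space_centralizes (rv_root_space eNP rc) cx0.
  have [f1 f2] := root_space_centralizes (rv_root_space eNP (is_rootN rc)) ncx0.
  by apply: root_uv_mem; apply/vvE.
have uv_m c : is_root c -> c x != 0 ->
    u_root k p e c \in m /\ v_root k p Dpos e c \in m.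
  move=> rc cx0; have ncx0 : (- c) x != 0 by rewrite opp_lfunE oppr_eq0.
  have E y (yvv : y \in vv) :=
    root_space_killing_eq0 (rv_root_space eNP rc) cx0 ((vvE y).1 yvv).
  have F y (yvv : y \in vv) :=
    root_space_killing_eq0 (rv_root_space eNP (is_rootN rc)) ncx0
      ((vvE y).1 yvv).
  by apply: root_uv_mem; apply/mP => y yvv;
    have [] := E y yvv; have [] := F y yvv.
pose mu := mcomp vv m.
have H_mu_u c : is_root c ->
    H (mu (u_root k p e c)) = (eps c)%:~R *: mu (v_root k p Dpos e c).
  move=> rc; rewrite /mu /mcomp; have [cx0|cx0] := eqVneq (c x) 0.
    have [uc vc] := uv_vv c rc cx0.
    by rewrite !daddv_pi_eq0 // linear0 scaler0.
  have [uc vc] := uv_m c rc cx0.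
  by rewrite !daddv_pi_id // H_u.
(* For a = b the brackets of root vectors involve h_a; both sides vanish. *)
have [ab_eq|ab] := eqVneq a b.
  rewrite -ab_eq nijenhuisxx (N_convxx eNP) // N_conv_xNx.
  by rewrite !mulr0 !scale0r addr0.
(* Like a and b, the root a + b is positive at h_phi, so v_(a+b) is in m. *)
have N_mu_v : N_conv N a b *: mu (v_root k p Dpos e (a + b)) =
    N_conv N a b *: v_root k p Dpos e (a + b).
  have [->|[rab _]] := N_conv_eps eNP ra rb; first by rewrite !scale0r.
  rewrite /mu /mcomp daddv_pi_id //; apply: (uv_m _ rab _).2.
  rewrite add_lfunE; apply: lt0r_neq0; apply: addr_gt0.
    by rewrite -dual_formE // lt0r a_phi phi_ge0.
  by rewrite -dual_formE // lt0r b_phi phi_ge0.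
have N_H_mu_u c : is_root c -> eps c = eps b ->
    N_conv N a c *: H (mu (u_root k p e (a + c))) =
    - (eps a * eps b)%:~R *: (N_conv N a c *: mu (v_root k p Dpos e (a + c))).
  move=> rc ec; have [->|[rac eac]] := N_conv_eps eNP ra rc.
    by rewrite !scale0r scaler0.
  by rewrite H_mu_u // /eps eac -/(eps c) ec !scalerA rmorphN mulrC.
have N_H_mu_sum := N_H_mu_u b rb erefl.
have N_H_mu_dif := N_H_mu_u (- b) rnb (root_epsN eNP rb).
rewrite /nijenhuis !H_u //.
rewrite !lieZl !lieZr (lie_uu eNP DposP) // (lie_vv eNP DposP) //.
rewrite (lie_uv eNP DposP) // (lie_vu eNP DposP) //.
rewrite -/mu.
have muD y z : mu (y + z) = mu y + mu z by apply: linearD.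
have muZ (r : R) y : mu (r *: y) = r *: mu y by apply: linearZ.
have muN y : mu (- y) = - mu y by apply: linearN.
have HD y z : H (y + z) = H y + H z by apply: linearD.
have HZ (r : R) y : H (r *: y) = r *: H y by apply: linearZ.
have HN y : H (- y) = - H y by apply: linearN.
rewrite !(muD, muZ, muN, HD, HZ, HN) -/(eps a) -/(eps b) -/(s (a - b)).
rewrite ![_ * (_ * N_conv N a _)]mulrA -!(scalerA _ (N_conv N _ _)).
rewrite N_H_mu_sum N_H_mu_dif N_mu_v.
move: (_ *: v_root _ _ _ _ _) (_ *: mu _) => X Y.
have sab : (eps a == 1) || (eps a == -1) := root_eps_e eNP ra.
have sbb : (eps b == 1) || (eps b == -1) := root_eps_e eNP rb.
have s2 : Num.sqrt 2 != 0 :> R := sqrt2_neq0.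
rewrite !(scalerDr, scalerN, scaleNr, scalerA).
rewrite -![- (_ *: X)]scaleNr -![- (_ *: Y)]scaleNr !scale_comb.
(* As [coef_sgn] is defined by cases, the coefficients of X and Y are compared
   for each of the four values of the pair (eps a, eps b). *)
move: (s (a - b)) sab sbb => t; rewrite /coef_sgn.
move: (eps a) (eps b) => m1 n1 /orP [] /eqP -> /orP [] /eqP ->.
all: by congr (_ *: _ + _ *: _); rewrite ?eqxx /=; field.
Qed.
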